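(* Let $G$ be a finite non-abelian group with center $Z(G)$. Let $p$ be the smallest prime divisor of $|G:Z(G)|$, and let $m=|G:Z(G)|$. Then for every integer $n\ge 0$, $$\frac{mn+m-n}{m^{n+1}}\leq P_2(G,n+1)\leq \frac{p^{n+1}+p^n-1}{p^{2n+1}}.$$
   Context: For an integer $k\ge 1$, $P_2(G,k)=|\mathrm{Hom}(\mathbb{Z}^k,G)|/|G|^k$, where $\mathrm{Hom}(\mathbb{Z}^k,G)$ is identified with the set of ordered $k$-tuples of pairwise commuting elements of $G$. *)

(* Defs.v *)
From mathcomp Require Import all_boot all_order all_algebra all_fingroup all_solvable.

Set Implicit Arguments.
Unset Strict Implicit.
Unset Printing Implicit Defensive.

Import GroupScope.

(* Hom(Z^k, G), a homomorphism being identified with the k-tuple of images of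
   the standard generators of Z^k. *)
Definition HomZ (gT : finGroupType) (G : {set gT}) (k : nat) :
    {set k.-tuple gT} :=
  [set t : k.-tuple gT |
    [forall i : 'I_k, tnth t i \in G] &&
    [forall i : 'I_k, forall j : 'I_k,
       tnth t i * tnth t j == tnth t j * tnth t i]].

Definition P2 (gT : finGroupType) (G : {set gT}) (k : nat) : rat :=
  (#|HomZ G k|%:R / #|G|%:R ^+ k)%R.

(* Main.v *)
Require Import Defs.
From mathcomp Require Import all_boot all_order all_algebra all_fingroup all_solvable.
From mathcomp Require Import ring.

(** Write [h_k(G)] for the number of commuting [k]-tuples of [G].  Choosing the
    first entry [x] of such a tuple leaves a commuting tuple of ['C_G[x]], so
      [h_{k+1}(G) = \sum_(x in G) h_k('C_G[x])].
    A central [x] contributes [h_k(G)].  A non-central one contributes at least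
    [|Z(G)|^k], all tuples over the centre being commuting, and at most
    [(|G| / p)^k], because the index of ['C_G[x]] is a divisor of [m] greater
    than [1].  Dividing by powers of [|G|], and writing [P_k] for [P2 G k],
      [1/m * P_k + (1 - 1/m) / m^k <= P_{k+1} <= 1/m * P_k + (1 - 1/m) / p^k].
    Both bounds follow by induction from [P_1 = 1]: the lower one satisfies its
    recursion with equality, and the upper one satisfies its recursion with
    equality when [m = p^2].  In general [m >= p^2], since [G / Z(G)] is not
    cyclic and so [m] is not prime, and the right-hand side above decreases in [m] as soon as [P_k] is
    replaced by a bound that is at least [1 / p^k]. *)

Import Order.TTheory GRing.Theory Num.Theory.

(** * Counting commuting tuples *)

Section CommutingTuples.

Import GroupScope.

Variable gT : finGroupType.
Implicit Types (A B : {set gT}) (G : {group gT}).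

Lemma HomZ_cons A k (x : gT) (t : k.-tuple gT) :
  ([tuple of x :: t] \in HomZ A k.+1) = (x \in A) && (t \in HomZ 'C_A[x] k).
Proof.
rewrite !inE; apply/idP/idP.
  case/andP=> /forallP tA /forallP tC.
  have tAx i : tnth t i \in A by have := tA (lift ord0 i); rewrite tnthS.
  have xA : x \in A by have := tA ord0; rewrite tnth0.
  rewrite xA /=; apply/andP; split; apply/forallP=> i.
    rewrite inE tAx; apply/cent1P.
    have /forallP/(_ (lift ord0 i))/eqP := tC ord0.
    by rewrite tnth0 tnthS.
  apply/forallP=> j; have /forallP/(_ (lift ord0 j)) := tC (lift ord0 i).
  by rewrite !tnthS.
case/andP=> xA /andP[/forallP tA /forallP tC].
have tx i : x * tnth t i = tnth t i * x.
  by have := tA i; rewrite inE => /andP[_ /cent1P].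
apply/andP; split; apply/forallP=> i.
  case: (unliftP ord0 i) => [j|] ->; rewrite ?tnth0 // tnthS.
  by have := tA j; rewrite inE => /andP[].
apply/forallP=> j.
case: (unliftP ord0 i) => [i'|] ->; case: (unliftP ord0 j) => [j'|] ->;
  rewrite ?tnth0 ?tnthS ?tx //.
by have /forallP := tC i'; apply.
Qed.

Lemma card_HomZ0 A : #|HomZ A 0| = 1%N.
Proof.
rewrite (_ : HomZ A 0 = setT) ?cardsT ?card_tuple ?expn0 //.
by apply/setP=> t; rewrite !inE; apply/andP; split; apply/forallP=> -[].
Qed.

(** The engine of all the counts below: tuples are sorted by their first entry.
    As the right-hand side replaces [A] by its centralisers, inductions on [k]
    have to keep [A] general. *)
Lemma card_HomZS A k : #|HomZ A k.+1| = (\sum_(x in A) #|HomZ 'C_A[x] k|)%N.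
Proof.
have headA (t : k.+1.-tuple gT) : t \in HomZ A k.+1 -> thead t \in A.
  by case/tupleP: t => x t; rewrite HomZ_cons theadE => /andP[].
rewrite -sum1_card (partition_big _ (mem A) headA) /=; apply: eq_bigr => x xA.
rewrite sum1_card -(card_in_imset (f := fun t : k.-tuple gT => [tuple of x :: t])).
  apply: eq_card => t; rewrite unfold_in /=; apply/andP/imsetP.
    case/tupleP: t => y t [tA /eqP yx]; rewrite theadE in yx; subst y.
    by exists t => //; move: tA; rewrite HomZ_cons => /andP[].
  by case=> s sC ->; rewrite HomZ_cons xA sC theadE eqxx.
by move=> s t _ _ /(congr1 val)[st]; apply: val_inj.
Qed.

Lemma card_HomZ1 A : #|HomZ A 1| = #|A|.
Proof.
by rewrite card_HomZS -sum1_card; apply: eq_bigr => x _; rewrite card_HomZ0.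
Qed.

Lemma leq_card_HomZ A k : (#|HomZ A k| <= #|A| ^ k)%N.
Proof.
elim: k A => [|k IHk] A; first by rewrite card_HomZ0.
rewrite card_HomZS expnS -sum_nat_const; apply: leq_sum => x _.
apply: leq_trans (IHk _) _; case: k {IHk} => // k.
by rewrite leq_exp2r // subset_leq_card // subsetIl.
Qed.

Lemma abelian_leq_card_HomZ A B k :
  abelian A -> A \subset B -> (#|A| ^ k <= #|HomZ B k|)%N.
Proof.
move=> cAA; elim: k B => [|k IHk] B sAB; first by rewrite card_HomZ0.
rewrite card_HomZS expnS -sum_nat_const.
apply: (@leq_trans (\sum_(x in A) #|HomZ 'C_B[x] k|)%N); last first.
  rewrite [leqRHS](big_setID A) /= (setIidPr sAB); exact: leq_addr.
apply: leq_sum => x Ax; apply: IHk; rewrite subsetI sAB.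
by rewrite (subset_trans cAA) // -cent_set1 centS ?sub1set.
Qed.

(** A central first entry puts no constraint on the remaining ones. *)
Lemma card_HomZS_center G k :
  #|HomZ G k.+1| = (#|'Z(G)| * #|HomZ G k|
                    + \sum_(x in G :\: 'Z(G)) #|HomZ 'C_G[x] k|)%N.
Proof.
rewrite card_HomZS (big_setID 'Z(G)) /= (setIidPr (center_sub G)).
congr addn; rewrite -sum_nat_const; apply: eq_bigr => x /centerP[_ cGx].
congr #|HomZ _ k| => //; apply/setIidPl/subsetP=> y Gy.
by apply/cent1P; rewrite /commute cGx.
Qed.

(** * Indices in a non-abelian group *)

Lemma center_sub_cent1 G x : x \in G -> 'Z(G) \subset 'C_G[x].
Proof.
move=> Gx; apply/subsetP=> y /centerP[Gy cGy].
by rewrite inE Gy; apply/cent1P; apply: cGy.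
Qed.

(** The index of ['C_G[x]] divides [|G : Z(G)|] and is not [1]. *)
Lemma card_cent1_noncentral G x :
  x \in G :\: 'Z(G) -> (#|'C_G[x]| * pdiv #|G : 'Z(G)| <= #|G|)%N.
Proof.
case/setDP=> Gx nZx; rewrite -(Lagrange (subsetIl G 'C[x])) leq_mul2l.
apply/orP; right; apply: pdiv_min_dvd.
  rewrite ltn_neqAle indexg_gt0 andbT eq_sym.
  apply: contra nZx => /eqP/index1g => /(_ (subsetIl _ _)) CG.
  by apply/centerP; split=> // y; rewrite -{1}CG => /setIP[_ /cent1P].
by apply: indexgS; apply: center_sub_cent1.
Qed.

Lemma index_center_gt1 G : ~~ abelian G -> (1 < #|G : 'Z(G)|)%N.
Proof.
move=> nabG; rewrite indexg_gt1; apply: contra nabG => sGZ.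
by apply: abelianS sGZ (center_abelian G).
Qed.

Lemma index_center_pdiv_sqr G :
  ~~ abelian G -> (pdiv #|G : 'Z(G)| ^ 2 <= #|G : 'Z(G)|)%N.
Proof.
move=> nabG; have m1 := index_center_gt1 _ nabG; rewrite leqNgt.
(* A number below the square of its smallest prime divisor is prime. *)
apply: contra nabG => /(ltn_pdiv2_prime (ltnW m1)) m_pr.
apply: cyclic_center_factor_abelian; apply: prime_cyclic.
by rewrite card_quotient ?normal_norm ?center_normal.
Qed.

End CommutingTuples.

(** * Passing to commuting probabilities *)

Local Open Scope ring_scope.

Lemma P2_1 (gT : finGroupType) (G : {group gT}) : P2 G 1 = 1.
Proof. by rewrite /P2 card_HomZ1 expr1 divff // pnatr_eq0 -lt0n cardG_gt0. Qed.

Lemma card_center_ratio (gT : finGroupType) (G : {group gT}) :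
  #|'Z(G)%g|%:R / #|G|%:R = #|G : 'Z(G)|%g%:R^-1 :> rat.
Proof.
rewrite -(Lagrange (center_sub G)) natrM invfM mulrA divff ?mul1r //.
by rewrite pnatr_eq0 -lt0n cardG_gt0.
Qed.

Lemma P2S_center (gT : finGroupType) (G : {group gT}) k :
  P2 G k.+1 = #|G : 'Z(G)|%g%:R^-1 * P2 G k
    + (\sum_(x in G :\: 'Z(G)%g) #|HomZ 'C_G[x]%g k|)%N%:R / #|G|%:R ^+ k.+1.
Proof.
rewrite /P2 card_HomZS_center natrD natrM mulrDl; congr (_ + _).
by rewrite -card_center_ratio exprS invfM; ring.
Qed.

Lemma card_noncentral_ratio (gT : finGroupType) (G : {group gT}) :
  #|G :\: 'Z(G)%g|%:R / #|G|%:R = 1 - #|G : 'Z(G)|%g%:R^-1 :> rat.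
Proof.
rewrite cardsD (setIidPr (center_sub G)) natrB ?subset_leq_card ?center_sub //.
rewrite mulrBl card_center_ratio divff //.
by rewrite pnatr_eq0 -lt0n cardG_gt0.
Qed.

(** The lower bound on the second summand comes from the tuples over the
    centre, which lie in every centraliser. *)
Lemma P2S_ge (gT : finGroupType) (G : {group gT}) k :
  #|G : 'Z(G)|%g%:R^-1 * P2 G k
    + (1 - #|G : 'Z(G)|%g%:R^-1) * #|G : 'Z(G)|%g%:R^-1 ^+ k <= P2 G k.+1.
Proof.
rewrite P2S_center lerD2l -card_noncentral_ratio -card_center_ratio.
rewrite expr_div_n exprS [X in _ <= _ / X]mulrC.
rewrite mulf_div [X in _ / X <= _]mulrC ler_wpM2r //.
  by rewrite invr_ge0 mulr_ge0 ?exprn_ge0.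
rewrite -natrX -natrM ler_nat -sum_nat_const leq_sum // => x Gx.
apply: abelian_leq_card_HomZ; first exact: center_abelian.
by apply: center_sub_cent1; case/setDP: Gx.
Qed.

(** The upper bound on the second summand counts all tuples of a proper
    centraliser, whose order is at most [|G| / p]. *)
Lemma P2S_le (gT : finGroupType) (G : {group gT}) k :
  P2 G k.+1 <= #|G : 'Z(G)|%g%:R^-1 * P2 G k
    + (1 - #|G : 'Z(G)|%g%:R^-1) * (pdiv #|G : 'Z(G)|%g)%:R^-1 ^+ k.
Proof.
have G0 : (0 : rat) < #|G|%:R by rewrite ltr0n cardG_gt0.
have p0 : (0 : rat) < (pdiv #|G : 'Z(G)|%g)%:R.
  by rewrite ltr0n pdiv_gt0.
rewrite P2S_center lerD2l -card_noncentral_ratio exprS invfM mulrA.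
rewrite ler_pdivrMr ?exprn_gt0 // -mulrA -exprMn [leRHS]mulrAC.
rewrite ler_pM2r ?invr_gt0 // (mulrC _^-1).
rewrite natr_sum mulr_natl -sumr_const; apply: ler_sum => x Gx.
apply: (@le_trans _ _ (#|'C_G[x]%g|%:R ^+ k)).
  by rewrite -natrX ler_nat leq_card_HomZ.
apply: lerXn2r; rewrite ?nnegrE ?divr_ge0 // ler_pdivlMr //.
by rewrite -natrM ler_nat card_cent1_noncentral.
Qed.

Theorem proposition6p5 (gT : finGroupType) (G : {group gT})
    (hG : ~~ abelian G)
    (m p : nat) (hm : m = #|G : 'Z(G)|%g) (hp : p = pdiv m) (n : nat) :
  (m%:R * n%:R + m%:R - n%:R) / m%:R ^+ n.+1 <= P2 G n.+1
  /\ P2 G n.+1 <= (p%:R ^+ n.+1 + p%:R ^+ n - 1) / p%:R ^+ (2 * n + 1)%N.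
Proof.
have m0 : (0 : rat) < m%:R by rewrite ltr0n hm ltnW ?index_center_gt1.
have p1 : (1 : rat) <= p%:R by rewrite ler1n hp pdiv_gt0.
have p0 : (0 : rat) < p%:R by apply: lt_le_trans p1.
have pm : p%:R ^+ 2 <= m%:R :> rat.
  by rewrite -natrX ler_nat hp hm index_center_pdiv_sqr.
split; elim: n => [|n IHn].
- by rewrite P2_1 expr1 mulr0 add0r subr0 divff ?gt_eqF.
- apply: le_trans (P2S_ge _ G n.+1); rewrite -hm.
  apply: (@le_trans _ _ (m%:R^-1 * ((m%:R * n%:R + m%:R - n%:R) / m%:R ^+ n.+1)
                         + (1 - m%:R^-1) * m%:R^-1 ^+ n.+1)).
    rewrite le_eqVlt; apply/orP; left; apply/eqP.
    rewrite -natr1 exprVn !exprS; field.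
    by rewrite expf_neq0 gt_eqF.
  by rewrite lerD2r ler_pM2l ?invr_gt0.
- rewrite P2_1 muln0 add0n expr0 !expr1 addrK divff //.
  by rewrite gt_eqF.
- apply: le_trans (P2S_le _ G n.+1) _; rewrite -hm -hp.
  set U := _ / _ in IHn; set q : rat := p%:R^-1 ^+ n.+1.
  (* The bound exceeds [p^-(n+1)], so the weight of the convex combination of
     the two can be raised from [1/m] to [1/p^2]. *)
  have Uq : U = q + (p%:R ^+ n.+1 - 1) / p%:R ^+ (2 * n + 1)%N.
    rewrite /U /q exprVn mul2n -addnn !exprD expr1 exprS; field.
    by rewrite expf_neq0 gt_eqF.
  have qU : q <= U.
    rewrite Uq lerDl; apply: divr_ge0; last by rewrite exprn_ge0.
    by rewrite subr_ge0 exprn_ege1.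
  apply: (@le_trans _ _ (m%:R^-1 * U + (1 - m%:R^-1) * q)).
    by rewrite lerD2r ler_pM2l ?invr_gt0.
  apply: (@le_trans _ _ (q + (p%:R ^+ 2)^-1 * (U - q))).
    rewrite mulrBl mul1r addrCA lerD2l -mulrBr ler_wpM2r ?subr_ge0 //.
    by rewrite lef_pV2 ?posrE ?exprn_gt0.
  rewrite Uq /q exprVn mulnS (addnC 2) addnAC exprD !exprS mul2n -addnn !exprD.
  rewrite le_eqVlt; apply/orP; left; apply/eqP; field.
  by rewrite expf_neq0 gt_eqF.
Qed.
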